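(* Let $r>0$, $0\le R<\infty$, $\varkappa=R/r$, and let $P$ be a random point uniformly distributed over the area of the disk $D_R$. Let $U_\varkappa$ be the perimeter of the ellipse generated by $P$ under the elliptic motion. Then $$ \mathbb{E}[U_\varkappa]= \begin{cases} 2\pi r & \text{if } \varkappa=0,\\[4pt] \dfrac{8r}{9\varkappa^2}\left[(7\varkappa^2+1)E(\varkappa)+(3\varkappa^4-2\varkappa^2-1)K(\varkappa)\right] & \text{if } 0<\varkappa<1,\\[8pt] \dfrac{64r}{9} & \text{if } \varkappa=1,\\[8pt] \dfrac{8r}{9\varkappa}\left[(7\varkappa^2+1)E(\varkappa^{-1})-4(\varkappa^2-1)K(\varkappa^{-1})\right] & \text{if } \varkappa>1. \end{cases} $$ Moreover, for all $\varkappa$ with $0<\varkappa<1$ or $\varkappa>1$, $$ \mathbb{E}[U_\varkappa]=\frac{4(\varkappa+1)r}{9\varkappa^2}\left[(7\varkappa^2+1)\,E\!\left(\frac{2\sqrt{\varkappa}}{\varkappa+1}\right)-(\varkappa-1)^2\,K\!\left(\frac{2\sqrt{\varkappa}}{\varkappa+1}\right)\right]. $$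
   Context: Elliptic motion: a circle of radius $r$ with centre $\varOmega$, attached to a moving plane $\varSigma$ with Cartesian coordinates $(\xi,\eta)$ and origin $\varOmega$, rolls inside a fixed circle of radius $2r$ centred at the origin $O$ of a fixed plane. A point $P=(\xi,\eta)\in\varSigma$ generates in the fixed plane (identified with $\mathbb{C}$) the closed curve $$X(\varphi)=r\,\mathrm{e}^{\mathrm{i}\varphi}+(\xi+\mathrm{i}\eta)\,\mathrm{e}^{-\mathrm{i}\varphi},\qquad 0\le\varphi<2\pi .$$ With $\varrho=\sqrt{\xi^2+\eta^2}$ this is an ellipse with semi-axes $r+\varrho$ and $|r-\varrho|$ (degenerating to a doubly traversed line segment of length $4r$ if $\varrho=r$). ''The ellipse generated by $P$'' means this curve, and its perimeter is the length of the curve over one period $0\le\varphi<2\pi$ (so it is $8r$ in the degenerate case). The disk is $D_R=\{(\xi,\eta)\in\varSigma: 0\le\xi^2+\eta^2\le R^2\}$. For $R=0$ the disk is the single point $\varOmega$ and $P=\varOmega$. The complete elliptic integrals of the first and second kind with modulus $k$ (not parameter $k^2$), $0\le k\le 1$, are $$K(k)=\int_0^{\pi/2}\frac{\mathrm{d}\theta}{\sqrt{1-k^2\sin^2\theta}},\qquad E(k)=\int_0^{\pi/2}\sqrt{1-k^2\sin^2\theta}\;\mathrm{d}\theta ,$$ with $K(1)=\infty$. *)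

(* Defs.v *)
From HB Require Import structures.
From mathcomp Require Import all_boot all_order all_algebra.
From mathcomp Require Import all_classical all_reals all_analysis.
From mathcomp Require Import complex.

Set Implicit Arguments.
Unset Strict Implicit.
Unset Printing Implicit Defensive.

Import Order.TTheory GRing.Theory Num.Theory.
Import numFieldNormedType.Exports.

Local Open Scope classical_set_scope.
Local Open Scope ring_scope.

Definition cexpi (R : realType) (t : R) : R[i] := Complex (cos t) (sin t).

(* The point (xi, eta) of the moving plane is the pair p. *)
Definition elliptic_curve (R : realType) (r : R) (p : R * R) (phi : R) : R[i] :=
  Complex r 0 * cexpi phi + Complex p.1 p.2 * cexpi (- phi).

(* Arc length of the C^1 curve X over a set D of parameters: the integral over
   D of |X'|, the derivative being taken componentwise. *)
Definition curve_length (R : realType) (X : R -> R[i]) (D : set R) : R :=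
  \int[lebesgue_measure]_(t in D)
    Normc.normc (Complex (derive1 (fun s => complex.Re (X s)) t)
                         (derive1 (fun s => complex.Im (X s)) t)).

Definition perimeter (R : realType) (r : R) (p : R * R) : R :=
  curve_length (elliptic_curve r p) `[0, 2 * pi[.

Definition disk (R : realType) (a : R) : set (R * R) :=
  [set p | p.1 ^+ 2 + p.2 ^+ 2 <= a ^+ 2].

Definition area (R : realType) : set (R * R) -> \bar R :=
  (@lebesgue_measure R \x @lebesgue_measure R)%E.

(* The disk of radius 0 has zero area; its uniform law is the Dirac mass at the
   only point of the disk. *)
Definition uniform_disk (R : realType) (a : R) (A : set (R * R)) : \bar R :=
  if a == 0 then \d_((0, 0) : R * R) A
  else (area (A `&` disk a) / area (disk a))%E.

Definition uniformly_distributed_on_disk d (T : measurableType d)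
    (R : realType) (P : probability T R) (a : R) (Z : {RV P >-> (R * R)%type}) :
    Prop :=
  forall A : set (R * R), measurable A ->
    distribution P Z A = uniform_disk a A.

(* Complete elliptic integrals with modulus k (not parameter k ^ 2), as
   extended reals, so that ellipticK 1 = +oo. The integrand of ellipticK 1 is
   0^-1 = 0 at pi / 2, a single point. *)
Definition ellipticK (R : realType) (k : R) : \bar R :=
  (\int[lebesgue_measure]_(t in `[0%R, (pi / 2)%R])
     ((Num.sqrt (1 - k ^+ 2 * sin t ^+ 2))^-1)%:E)%E.

Definition ellipticE (R : realType) (k : R) : \bar R :=
  (\int[lebesgue_measure]_(t in `[0%R, (pi / 2)%R])
     (Num.sqrt (1 - k ^+ 2 * sin t ^+ 2))%:E)%E.

(* Main.v *)
Require Import Defs.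
From mathcomp Require Import all_boot all_order all_algebra.
From mathcomp Require Import all_classical all_reals all_analysis.
From mathcomp Require Import measurable_realfun complex ring lra.
Set Implicit Arguments.
Unset Strict Implicit.
Unset Printing Implicit Defensive.
Import Order.TTheory GRing.Theory Num.Theory.
Import numFieldNormedType.Exports.
Local Open Scope classical_set_scope.
Local Open Scope ring_scope.

(** The curve of a point [P] at distance [rho] from the centre has speed
    [r * sqrt (1 + k^2 + 2 k cos (2 (t - b)))] with [k = rho / r] and a phase
    [b] that depends on the direction of [P].  This speed is even and
    [pi]-periodic around [b], so the perimeter depends on [rho] only and equals
    [4 r I(k)], where
      [I(k) = int_0^(pi/2) sqrt w],  [J(k) = int_0^(pi/2) 1 / sqrt w],
      [w = 1 + k^2 + 2 k cos (2 t) = (1 + k)^2 - 4 k (sin t)^2]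
    ([perimeterE]; [I], [J] and [w] are [dist_integral], [invdist_integral] and [sqdist]).  The last form of [w] says that [I] and [J] are, up to the
    factor [1 + k], the complete integrals [E] and [K] of modulus
    [2 sqrt k / (k + 1)].

    The area of a disk is proportional to the square of its radius, so the
    squared distance of a uniform point of the disk is uniform on [[0, a^2]]
    ([sqnorm2_law]).  Hence the expectation is
    [4 r / a^2 * int_0^(a^2) I(sqrt x / r) dx], and no polar coordinates in the
    plane are needed.  The substitution [x = r^2 k^2] asks for a primitive of
    [k I(k)], and one is
      [G(k) = ((7 k^2 + 1) I(k) - (k^2 - 1)^2 J(k)) / 18],
    called [radial_primitive] below.  Indeed the [k]-derivative of the integrand of [G] differs from [k sqrt w] by
    [(k^2 - 1) / 18] times the [t]-derivative of [sin (2 t) / sqrt w], and this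
    quotient vanishes at [0] and [pi / 2] ([is_derive_radial_primitive]).  At [k = 1]
    the integral [J] diverges, but [(k^2 - 1)^2 J] tends to [0], so [G] is
    continuous there ([continuous_radial_primitive]) and the fundamental theorem
    applies on both sides of [1] ([Rintegral_dist_integral_sqrt]).  The
    expectation is [8 r G(k) / k^2] with [k = a / r] ([expectation_perimeter]).

    This is already the formula in the modulus [2 sqrt k / (k + 1)].  For
    [k < 1] the formula in the modulus [k] follows from Landen's transformation
    [J(k) = K(k)], [I(k) = 2 E(k) - (1 - k^2) K(k)] ([ellipticK_landen],
    [ellipticE_landen]).  For [k > 1] the relation [w(k) = k^2 w(1/k)] reduces
    to the modulus [1/k], and for [k = 1] one has [I(1) = 2]. *)

(** * Differentiation and integration on a segment *)

Section calculus.
Context {R : realType}.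
Implicit Types (f g F : R -> R) (x a b c : R).
Notation mu := (@lebesgue_measure R).

Lemma is_derive_cst1 c x : is_derive x (1 : R) (fun _ : R => c) 0.
Proof. exact: is_derive_cst. Qed.

Lemma is_derive_id1 x : is_derive x (1 : R) (fun y : R => y) 1.
Proof. exact: is_derive_id. Qed.

Lemma is_derive_add f g x a b : is_derive x 1 f a -> is_derive x 1 g b ->
  is_derive x 1 (fun y => f y + g y) (a + b).
Proof. by move=> hf hg; exact: (is_deriveD hf hg). Qed.

Lemma is_derive_sub f g x a b : is_derive x 1 f a -> is_derive x 1 g b ->
  is_derive x 1 (fun y => f y - g y) (a - b).
Proof. by move=> hf hg; exact: (is_deriveB hf hg). Qed.

Lemma is_derive_mul f g x a b : is_derive x 1 f a -> is_derive x 1 g b ->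
  is_derive x 1 (fun y => f y * g y) (f x * b + g x * a).
Proof. by move=> hf hg; exact: (is_deriveM hf hg). Qed.

Lemma is_derive_comp f g x a b : is_derive (g x) 1 f a -> is_derive x 1 g b ->
  is_derive x 1 (fun y => f (g y)) (a * b).
Proof. by move=> hf hg; exact: (is_derive1_comp hf hg). Qed.

Lemma is_derive_sqr f x a : is_derive x 1 f a ->
  is_derive x 1 (fun y => f y ^+ 2) (2 * f x * a).
Proof.
move=> hf; have h := is_deriveX 2 hf.
by apply: (is_derive_eq h); rewrite /= expr1.
Qed.

Lemma is_derive_inv f x a : f x != 0 -> is_derive x 1 f a ->
  is_derive x 1 (fun y => (f y)^-1) (- a / f x ^+ 2).
Proof.
move=> f0 hf; apply: (is_derive_eq (is_deriveV f0 hf)).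
by rewrite /GRing.scale /= mulrC mulrN mulNr.
Qed.

Lemma is_derive_sqrt f x a : 0 < f x -> is_derive x 1 f a ->
  is_derive x 1 (fun y => Num.sqrt (f y)) (a / (2 * Num.sqrt (f x))).
Proof.
move=> f0 hf; rewrite mulrC.
exact: (is_derive_comp (is_derive1_sqrt f0) hf).
Qed.

Lemma is_derive_continuous f x a : is_derive x 1 f a -> {for x, continuous f}.
Proof.
case=> /derivable1_diffP h _; exact: differentiable_continuous.
Qed.

Lemma continuous_itv f a b : continuous f -> {within `[a, b], continuous f}.
Proof. exact: continuous_subspaceT. Qed.

Lemma continuous_integrable f a b : continuous f ->
  mu.-integrable `[a, b] (EFin \o f).
Proof.
move=> cf; apply: continuous_compact_integrable; first exact: segment_compact.
exact: continuous_itv.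
Qed.

(** Continuity up to the end points and differentiability in the open interval
    suffice: the primitives used below contain square roots, which are not
    differentiable at one end. *)
Lemma FTC_Rintegral f F a b : a <= b ->
  {within `[a, b], continuous f} -> {within `[a, b], continuous F} ->
  (forall x, a < x < b -> is_derive x 1 F (f x)) ->
  \int[mu]_(x in `[a, b]) f x = F b - F a.
Proof.
rewrite le_eqVlt => /predU1P[-> _ _ _|ab cf cF dF].
  by rewrite set_itv1 Rintegral_set1 subrr.
rewrite /Rintegral (continuous_FTC2 (F := F) ab) //.
- have /(continuous_within_itvP _ ab)[_ ? ?] := cF; split => // x.
  by rewrite in_itv/= => /dF [].
- move=> x; rewrite in_itv/= => /dF h.
  by rewrite derive1E; exact: derive_val.
Qed.

Lemma eq_of_derive0 F a b : a <= b -> {within `[a, b], continuous F} ->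
  (forall x, a < x < b -> is_derive x 1 F 0) -> F a = F b.
Proof.
move=> ab cF dF; apply/esym/eqP; rewrite -subr_eq0.
rewrite -(FTC_Rintegral ab (f := cst 0) _ cF dF); last first.
  by apply: continuous_itv; exact: cst_continuous.
by rewrite Rintegral_cst// mul0r.
Qed.

(** The primitive is an integral from [N], so it is one only to the right of
    [N]; the choice of [N] leaves room for the arguments that occur. *)
Lemma ex_primitive f N : continuous f ->
  exists F, forall x, N < x -> is_derive x 1 F (f x).
Proof.
move=> cf; exists (fun x => \int[mu]_(t in `[N, x]) f t) => x Nx.
have [] := @continuous_FTC1_closed R f N x (x + 1) _ _ Nx (cf x).
- by rewrite ltrDl.
- exact: continuous_integrable.
- by rewrite derive1E => dF <-; split.
Qed.

Lemma Rintegral_cat f a b c : a <= b -> b <= c -> continuous f ->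
  \int[mu]_(x in `[a, c]) f x =
  \int[mu]_(x in `[a, b]) f x + \int[mu]_(x in `[b, c]) f x.
Proof.
move=> ab bc cf; have [F dF] := ex_primitive (a - 1) cf.
have cF x : a <= x -> {for x, continuous F}.
  move=> ax; apply: is_derive_continuous (dF _ _).
  by rewrite (lt_le_trans _ ax)// ltrBlDr ltrDl.
have E u v : a <= u -> u <= v -> \int[mu]_(x in `[u, v]) f x = F v - F u.
  move=> au uv; apply: FTC_Rintegral => //; first exact: continuous_itv.
    apply: continuous_in_subspaceT => x; rewrite inE/= in_itv/= => /andP[ux _].
    exact/cF/(le_trans au).
  move=> x /andP[ux _]; apply: dF.
  by rewrite ltrBlDr (le_lt_trans au)// (lt_trans ux)// ltrDl.
rewrite !E//; first by ring.
exact: le_trans bc.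
Qed.

End calculus.

(** * Integrals of symmetric and periodic functions, polar angle *)

Section quarter_period.
Context {R : realType}.
Implicit Types (f g F : R -> R) (x a b c : R).
Notation mu := (@lebesgue_measure R).

Lemma pi_halfD : pi / 2 + pi / 2 = pi :> R.
Proof. by field. Qed.

Lemma Rintegral_primitive f F N a b : continuous f ->
  (forall x, N < x -> is_derive x 1 F (f x)) -> N < a -> a <= b ->
  \int[mu]_(x in `[a, b]) f x = F b - F a.
Proof.
move=> cf dF Na ab; apply: FTC_Rintegral => //; first exact: continuous_itv.
  apply: continuous_in_subspaceT => x; rewrite inE/= in_itv/= => /andP[ax _].
  exact: is_derive_continuous (dF _ (lt_le_trans Na ax)).
by move=> x /andP[ax _]; exact/dF/(lt_trans Na).
Qed.

Lemma is_derive_shiftl f F N c x : (forall x, N < x -> is_derive x 1 F (f x)) ->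
  N < c + x -> is_derive x 1 (fun y => F (c + y)) (f (c + x)).
Proof.
move=> dF Nx; rewrite -[f _]mulr1; apply: is_derive_comp; first exact: dF.
by apply: (is_derive_eq (is_derive_add (is_derive_cst1 c x) (is_derive_id1 x))); rewrite add0r.
Qed.

Lemma is_derive_reflect f F N c x : (forall x, N < x -> is_derive x 1 F (f x)) ->
  N < c - x -> is_derive x 1 (fun y => F (c - y)) (- f (c - x)).
Proof.
move=> dF Nx; rewrite -[f _]mulr1 -mulrN; apply: is_derive_comp; first exact: dF.
by apply: (is_derive_eq (is_derive_sub (is_derive_cst1 c x) (is_derive_id1 x))); rewrite sub0r.
Qed.

(** With [F] a primitive of [f], the sum [F y + F (c + c - y)] has derivative
    zero. *)
Lemma Rintegral_symmetric f c : 0 <= c -> continuous f ->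
  (forall x, f (c + c - x) = f x) ->
  \int[mu]_(x in `[0, c + c]) f x = 2 * \int[mu]_(x in `[0, c]) f x.
Proof.
move=> c0 cf fs; have [F dF] := ex_primitive (-1) cf.
have N0 : -1 < 0 :> R by lra.
rewrite !(Rintegral_primitive cf dF)//; last by lra.
have dU x : 0 <= x <= c -> is_derive x 1 (fun y => F y + F (c + c - y)) 0.
  move=> /andP[x0 xc]; rewrite -[0](subrr (f x)) -[X in _ - X]fs.
  apply: is_derive_add; first by apply: dF; lra.
  by apply: is_derive_reflect => //; lra.
have : F 0 + F (c + c - 0) = F c + F (c + c - c).
  apply: (eq_of_derive0 (F := fun y => F y + F (c + c - y)) c0).
    apply: continuous_in_subspaceT => x; rewrite inE/= in_itv/= => xc.
    exact: is_derive_continuous (dU _ xc).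
  by move=> x /andP[x0 xc]; apply: dU; rewrite !ltW.
by rewrite subr0 addrK; lra.
Qed.

(** With [F] a primitive of [f], the difference [F (2 pi - y) - F (- y)] is
    constant in [y] by periodicity, so the phase [b] may be removed; the
    symmetries of [f] about [pi] and [pi / 2] then halve the interval twice. *)
Lemma Rintegral_even_periodic f b : 0 <= b ->
  continuous f -> (forall x, f (- x) = f x) -> (forall x, f (x + pi) = f x) ->
  \int[mu]_(x in `[0, 2 * pi]) f (x - b) = 4 * \int[mu]_(x in `[0, pi / 2]) f x.
Proof.
move=> b0 cf fe fp; have pi0 := pi_gt0 R.
have [F dF] := ex_primitive (- b - 1) cf.
have f2p x : f (2 * pi - x) = f (- x).
  by rewrite (_ : 2 * pi - x = - x + pi + pi) ?fp//; ring.
transitivity (F (2 * pi - b) - F (- b)).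
  rewrite -[X in _ - F X]sub0r; apply: (FTC_Rintegral (F := fun y => F (y - b))).
  - by lra.
  - apply: continuous_itv => x; apply: continuous_comp; last exact: cf.
    by apply: cvgB; [exact: cvg_id|exact: cvg_cst].
  - apply: continuous_in_subspaceT => x; rewrite inE/= in_itv/= => /andP[x0 _].
    under eq_fun do rewrite addrC.
    by apply: is_derive_continuous (is_derive_shiftl dF _); lra.
  - move=> x /andP[x0 _]; under eq_fun do rewrite addrC.
    by rewrite addrC; apply: (is_derive_shiftl dF); lra.
transitivity (F (2 * pi - 0) - F (- 0)).
  apply/esym; have dU x : 0 <= x <= b ->
      is_derive x 1 (fun y => F (2 * pi - y) - F (0 - y)) 0.
    move=> /andP[x0 xb].
    apply: (is_derive_eq (df := 0)
      (f' := - f (2 * pi - x) - - f (0 - x))); last first.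
      by rewrite f2p sub0r subrr.
    by apply: is_derive_sub; apply: (is_derive_reflect dF); lra.
  rewrite -[X in _ = _ - F X]sub0r -[X in _ - F X = _]sub0r.
  apply: (eq_of_derive0 (F := fun y => F (2 * pi - y) - F (0 - y)) b0).
    apply: continuous_in_subspaceT => x; rewrite inE/= in_itv/= => xc.
    exact: is_derive_continuous (dU _ xc).
  by move=> x /andP[x0 xc]; apply: dU; rewrite !ltW.
rewrite subr0 oppr0 -(Rintegral_primitive cf dF); [|lra..].
rewrite (_ : 2 * pi = pi + pi); last by ring.
rewrite Rintegral_symmetric//; last 2 first.
- exact: ltW.
- by move=> x; rewrite -[in RHS]fe -f2p; congr f; ring.
rewrite -{1}pi_halfD Rintegral_symmetric//; last 2 first.
- by lra.
- by move=> x; rewrite pi_halfD -[RHS]fe -[RHS]fp; congr f; ring.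
by ring.
Qed.

(** A nonnegative angle is wanted because it becomes the phase [b] of
    [Rintegral_even_periodic]. *)
Lemma polar_angle a b : exists2 t, 0 <= t &
  a = Num.sqrt (a ^+ 2 + b ^+ 2) * cos t /\ b = Num.sqrt (a ^+ 2 + b ^+ 2) * sin t.
Proof.
have [r0|r0] := eqVneq (Num.sqrt (a ^+ 2 + b ^+ 2)) 0.
  have : a ^+ 2 + b ^+ 2 <= 0 by rewrite -sqrtr_eq0 r0.
  rewrite le_eqVlt ltNge addr_ge0 ?sqr_ge0//= orbF paddr_eq0 ?sqr_ge0//.
  by rewrite !sqrf_eq0 r0 => /andP[/eqP-> /eqP->]; exists 0 => //; rewrite !mul0r.
set r := Num.sqrt _ in r0 *.
have rp : 0 < r by rewrite lt_neqAle eq_sym r0 sqrtr_ge0.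
have r2 : r ^+ 2 = a ^+ 2 + b ^+ 2 by rewrite sqr_sqrtr// addr_ge0 ?sqr_ge0.
have ar : -1 <= a / r <= 1.
  rewrite -ler_norml normrM normfV (gtr0_norm rp) ler_pdivrMr// mul1r.
  by rewrite -[leRHS]gtr0_norm// -ler_sqr ?nnegrE// !real_normK ?num_real// r2 lerDl sqr_ge0.
have ca' : cos (acos (a / r)) = a / r by apply: acosK; rewrite in_itv.
have sa : `|sin (acos (a / r))| = `|b / r|.
  apply/eqP; rewrite -(@eqrXn2 _ 2)// !real_normK ?num_real// sin2cos2 ca'.
  rewrite !expr_div_n (_ : b ^+ 2 = r ^+ 2 - a ^+ 2); last by rewrite r2 addrC addrA addNr add0r.
  by apply/eqP; field.
have s0 : 0 <= sin (acos (a / r)) by rewrite sin_ge0_pi// acos_ge0 ?acos_lepi.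
(* [acos] gives the angle up to sign; a negative [b] needs the other one, moved
   to the nonnegative reals by a turn. *)
have [b0|b0] := leP 0 b.
  exists (acos (a / r)); first exact: acos_ge0.
  rewrite ca' -(ger0_norm s0) sa ger0_norm ?(divr_ge0 b0 (ltW rp))//.
  by split; field.
exists (2 * pi - acos (a / r)); first by (have := acos_lepi ar; have := pi_gt0 R; lra).
have -> : 2 * pi - acos (a / r) = - acos (a / r) + pi + pi by ring.
rewrite sinDpi sinDpi cosDpi cosDpi !opprK cosN sinN ca' -(ger0_norm s0) sa.
rewrite normrM normfV (gtr0_norm rp) (ltr0_norm b0).
by split; field.
Qed.

End quarter_period.

(** * The perimeter as a function of the distance to the centre *)

(** The squared distance between [-1] and the point of polar coordinates
    [(k, 2 t)]. *)
Definition sqdist {R : realType} (k t : R) : R := 1 + k ^+ 2 + 2 * k * cos (2 * t).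

Definition dist_integral {R : realType} (k : R) : R :=
  \int[lebesgue_measure]_(t in `[0, pi / 2]) Num.sqrt (sqdist k t).

Section perimeter.
Context {R : realType}.
Implicit Types (k t r a b : R).
Notation mu := (@lebesgue_measure R).

Lemma cos2M t : cos (2 * t) = 1 - 2 * sin t ^+ 2.
Proof. by rewrite mulrC mulr_natr cos_mulr2n cos2sin2; ring. Qed.

Lemma sin2M t : sin (2 * t) = 2 * sin t * cos t.
Proof. by rewrite mulrC mulr_natr sin_mulr2n; ring. Qed.

Lemma sqdist_ge k t : (1 - `|k|) ^+ 2 <= sqdist k t.
Proof.
rewrite /sqdist -[k ^+ 2 in leRHS]real_normK ?num_real//.
have : - `|k| <= k * cos (2 * t).
  rewrite lerNl (le_trans (ler_norm _))// normrN normrM ler_piMr//.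
  by rewrite ler_norml cos_geN1 cos_le1.
by nra.
Qed.

Lemma sqdist_le k t : sqdist k t <= (1 + `|k|) ^+ 2.
Proof.
rewrite /sqdist -[k ^+ 2 in leLHS]real_normK ?num_real//.
have : k * cos (2 * t) <= `|k|.
  rewrite (le_trans (ler_norm _))// normrM ler_piMr//.
  by rewrite ler_norml cos_geN1 cos_le1.
by nra.
Qed.

Lemma sqdist_ge0 k t : 0 <= sqdist k t.
Proof. exact: le_trans (sqr_ge0 _) (sqdist_ge k t). Qed.

Lemma sqdist_gt0 k t : k ^+ 2 != 1 -> 0 < sqdist k t.
Proof.
move=> k1; apply: lt_le_trans (sqdist_ge k t).
rewrite exprn_even_gt0//= subr_eq0 eq_sym.
by apply: contra k1 => /eqP k1; rewrite -real_normK ?num_real// k1 expr1n.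
Qed.

Lemma continuous_cos2M : continuous (fun t : R => cos (2 * t)).
Proof.
move=> t; apply: continuous_comp; last exact: continuous_cos.
by apply: cvgM; [exact: cvg_cst|exact: cvg_id].
Qed.

Lemma continuous_sqdist k : continuous (sqdist k).
Proof.
move=> t; rewrite /sqdist; apply: cvgD; first exact: cvg_cst.
by apply: cvgM; [exact: cvg_cst|exact: continuous_cos2M].
Qed.

Lemma continuous_dist k : continuous (fun t => Num.sqrt (sqdist k t)).
Proof.
move=> t; apply: continuous_comp; first exact: continuous_sqdist.
exact: sqrt_continuous.
Qed.

Lemma sqdistN k t : sqdist k (- t) = sqdist k t.
Proof. by rewrite /sqdist mulrN cosN. Qed.

Lemma sqdistDpi k t : sqdist k (t + pi) = sqdist k t.
Proof.
rewrite /sqdist (_ : 2 * (t + pi) = 2 * t + pi + pi); last by ring.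
by rewrite !cosDpi opprK.
Qed.

Lemma elliptic_speed r (p : R * R) t :
  Normc.normc (Complex (derive1 (fun s => complex.Re (elliptic_curve r p s)) t)
                       (derive1 (fun s => complex.Im (elliptic_curve r p s)) t)) =
  Num.sqrt (r ^+ 2 + (p.1 ^+ 2 + p.2 ^+ 2)
            - 2 * r * (p.1 * cos (2 * t) + p.2 * sin (2 * t))).
Proof.
case: p => x y /=; rewrite !derive1E.
have dc := is_derive_cos t; have ds := is_derive_sin t.
have -> : 'D_1 (fun s => r * cos s - 0 * sin s
    + (x * cos (- s) - y * sin (- s))) t = - (r + x) * sin t + y * cos t.
  have -> : (fun s => r * cos s - 0 * sin s + (x * cos (- s) - y * sin (- s))) =
      (fun s => (r + x) * cos s + y * sin s).
    by apply/funext => s; rewrite cosN sinN; ring.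
  apply: derive_val; apply: (is_derive_eq (is_derive_add
    (is_derive_mul (is_derive_cst1 _ _) dc) (is_derive_mul (is_derive_cst1 _ _) ds))).
  by ring.
have -> : 'D_1 (fun s => r * sin s + 0 * cos s
    + (x * sin (- s) + y * cos (- s))) t = (r - x) * cos t - y * sin t.
  have -> : (fun s => r * sin s + 0 * cos s + (x * sin (- s) + y * cos (- s))) =
      (fun s => (r - x) * sin s + y * cos s).
    by apply/funext => s; rewrite cosN sinN; ring.
  apply: derive_val; apply: (is_derive_eq (is_derive_add
    (is_derive_mul (is_derive_cst1 _ _) ds) (is_derive_mul (is_derive_cst1 _ _) dc))).
  by ring.
congr Num.sqrt; rewrite cos2M sin2M.
by have := cos2sin2 t => c2; ring: c2.
Qed.

(** Only the distance of the point to the centre matters: its direction is a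
    phase of an even [pi]-periodic integrand. *)
Lemma perimeterE r (p : R * R) : 0 < r ->
  perimeter r p = 4 * r * dist_integral (Num.sqrt (p.1 ^+ 2 + p.2 ^+ 2) / r).
Proof.
move=> r0; rewrite /perimeter /curve_length.
under eq_Rintegral do rewrite elliptic_speed.
case: p => x y /=; set rho := Num.sqrt _; set k := rho / r.
have [a a0 [xE yE]] := polar_angle (- x) (- y).
rewrite !sqrrN -/rho in xE yE.
have rho2 : rho ^+ 2 = x ^+ 2 + y ^+ 2 by rewrite sqr_sqrtr// addr_ge0 ?sqr_ge0.
have E t : Num.sqrt (r ^+ 2 + (x ^+ 2 + y ^+ 2)
    - 2 * r * (x * cos (2 * t) + y * sin (2 * t))) =
    r * Num.sqrt (sqdist k (t - a / 2)).
  rewrite -[in RHS](ger0_norm (ltW r0)) -sqrtr_sqr -sqrtrM ?sqr_ge0//; congr Num.sqrt.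
  rewrite /sqdist mulrBr (_ : 2 * (a / 2) = a); last by field.
  rewrite cosB -rho2 -[x]opprK -[y]opprK xE yE /k.
  by field; rewrite gt_eqF.
under eq_Rintegral do rewrite E.
have cE : continuous (fun t => Num.sqrt (sqdist k (t - a / 2))).
  move=> t; apply: (@continuous_comp _ _ _ (fun t => t - a / 2) (fun t => Num.sqrt (sqdist k t))).
    by apply: cvgB; [exact: cvg_id|exact: cvg_cst].
  exact: continuous_dist.
have rcE : continuous (fun t => r * Num.sqrt (sqdist k (t - a / 2))).
  by move=> t; apply: cvgM; [exact: cvg_cst|exact: cE].
rewrite Rintegral_itv_bndo_bndc; last first.
  apply: (@integrableS _ _ _ mu `[0, 2 * pi]) => //; last exact: continuous_integrable.
  by apply: subset_itvl; rewrite bnd_simp.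
rewrite RintegralZl//; last exact: continuous_integrable.
rewrite (Rintegral_even_periodic (f := fun t => Num.sqrt (sqdist k t))).
- by rewrite /dist_integral; ring.
- by rewrite divr_ge0.
- exact: continuous_dist.
- by move=> t; rewrite sqdistN.
- by move=> t; rewrite sqdistDpi.
Qed.

End perimeter.

(** * A primitive of the perimeter *)

Definition invdist_integral {R : realType} (k : R) : R :=
  \int[lebesgue_measure]_(t in `[0, pi / 2]) (Num.sqrt (sqdist k t))^-1.

Definition radial_primitive {R : realType} (k : R) : R :=
  ((7 * k ^+ 2 + 1) * dist_integral k - (k ^+ 2 - 1) ^+ 2 * invdist_integral k) / 18.

Section radial.
Context {R : realType}.
Implicit Types (k t r a x : R).
Notation mu := (@lebesgue_measure R).
Local Notation s k t := (Num.sqrt (sqdist k t)).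

Lemma dist_gt0 k t : k ^+ 2 != 1 -> 0 < s k t.
Proof. by move=> k1; rewrite sqrtr_gt0 sqdist_gt0. Qed.

Lemma dist_neq0 k t : k ^+ 2 != 1 -> s k t != 0.
Proof. by move=> k1; rewrite gt_eqF// dist_gt0. Qed.

Lemma sqr_dist k t : s k t ^+ 2 = sqdist k t.
Proof. by rewrite sqr_sqrtr// sqdist_ge0. Qed.

Lemma dist_ge k t : `|1 - `|k| | <= s k t.
Proof. by rewrite -sqrtr_sqr ler_wsqrtr// sqdist_ge. Qed.

Lemma dist_le k t : s k t <= 1 + `|k|.
Proof.
rewrite -[leRHS]ger0_norm ?addr_ge0// -sqrtr_sqr.
by rewrite ler_wsqrtr// sqdist_le.
Qed.

Lemma continuous_distV k : k ^+ 2 != 1 -> continuous (fun t => (s k t)^-1).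
Proof.
by move=> k1 t; apply: cvgV; [exact: dist_neq0|exact: continuous_dist].
Qed.

Lemma pihalf_ge0 : 0 <= pi / 2 :> R.
Proof. by rewrite divr_ge0// pi_ge0. Qed.

(** The integrand of [radial_primitive].  At [k ^+ 2 = 1] its second term is
    zero, so it is continuous in [t] even where [sqdist] vanishes. *)
Definition radial_kernel k t : R :=
  ((7 * k ^+ 2 + 1) * s k t - (k ^+ 2 - 1) ^+ 2 * (s k t)^-1) / 18.

Lemma continuous_radial_kernel k : continuous (radial_kernel k).
Proof.
have [k1|k1] := eqVneq (k ^+ 2) 1.
  move=> t; rewrite /radial_kernel k1 subrr expr0n/=.
  apply: cvgM; last exact: cvg_cst.
  under eq_fun do rewrite mul0r subr0.
  by rewrite mul0r subr0; apply: cvgM; [exact: cvg_cst|exact: continuous_dist].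
move=> t; apply: cvgM; last exact: cvg_cst.
apply: cvgB; apply: cvgM; try exact: cvg_cst; first exact: continuous_dist.
exact: continuous_distV.
Qed.

Lemma radial_primitiveE k :
  radial_primitive k = \int[mu]_(t in `[0, pi / 2]) radial_kernel k t.
Proof.
rewrite /radial_kernel RintegralZr//; last first.
  apply: continuous_integrable => t.
  have -> : (fun t => (7 * k ^+ 2 + 1) * s k t - (k ^+ 2 - 1) ^+ 2 * (s k t)^-1)
      = (fun t => radial_kernel k t * 18).
    by apply/funext => y; rewrite /radial_kernel divfK.
  by apply: cvgM; [exact: continuous_radial_kernel|exact: cvg_cst].
congr (_ / _); have [k1|k1] := eqVneq (k ^+ 2) 1.
  rewrite k1 subrr expr0n/= mul0r subr0 /dist_integral -RintegralZl//.
    by apply: eq_Rintegral => t _; rewrite mul0r subr0.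
  exact: continuous_integrable (@continuous_dist _ k).
have cI := continuous_integrable 0 (pi / 2) (@continuous_dist _ k).
have cJ := continuous_integrable 0 (pi / 2) (continuous_distV k1).
rewrite RintegralB//.
- by rewrite !RintegralZl.
- apply: continuous_integrable => t.
  by apply: cvgM; [exact: cvg_cst|exact: continuous_dist].
- apply: continuous_integrable => t.
  by apply: cvgM; [exact: cvg_cst|exact: continuous_distV].
Qed.

Definition angular_derivative k t : R :=
  2 * cos (2 * t) / s k t + 2 * k * sin (2 * t) ^+ 2 / s k t ^+ 3.

Definition radial_kernel_derivative k t : R :=
  k * s k t - (k ^+ 2 - 1) / 18 * angular_derivative k t.

Lemma is_derive_angular k t : k ^+ 2 != 1 ->
  is_derive t 1 (fun y => sin (2 * y) / s k y) (angular_derivative k t).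
Proof.
move=> k1; have s0 := dist_neq0 t k1; have w0 := sqdist_gt0 t k1.
have d2 : is_derive t 1 (fun y : R => 2 * y) 2.
  apply: (is_derive_eq (is_derive_mul (is_derive_cst1 2 t) (is_derive_id1 t))).
  by ring.
have dw : is_derive t 1 (sqdist k) (- 4 * k * sin (2 * t)).
  apply: (is_derive_eq (is_derive_add (is_derive_cst1 (1 + k ^+ 2) t)
    (is_derive_mul (is_derive_cst1 (2 * k) t) (is_derive_comp (is_derive_cos _) d2)))).
  by ring.
apply: (is_derive_eq (is_derive_mul (is_derive_comp (is_derive_sin _) d2)
  (is_derive_inv (f := fun y => s k y) s0 (is_derive_sqrt w0 dw)))).
by rewrite /angular_derivative; field.
Qed.

(** The identity on which the whole computation rests.  After multiplication by
    [q ^+ 3], where [q] is the distance, it becomes polynomial in [k], [cos (2 t)]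
    and [q ^+ 2]. *)
Lemma is_derive_radial_kernel k t : k ^+ 2 != 1 ->
  is_derive k 1 (radial_kernel ^~ t) (radial_kernel_derivative k t).
Proof.
move=> k1; have s0 := dist_neq0 t k1; have w0 := sqdist_gt0 t k1.
have dk := is_derive_id1 k; have dk2 := is_derive_sqr dk.
pose c := cos (2 * t).
have dw : is_derive k 1 (sqdist ^~ t) (2 * k + 2 * c).
  apply: (is_derive_eq (is_derive_add (is_derive_add (is_derive_cst1 1 k) dk2)
    (is_derive_mul (is_derive_mul (is_derive_cst1 2 k) dk) (is_derive_cst1 c k)))).
  by ring.
have ds := is_derive_sqrt (f := sqdist ^~ t) w0 dw.
apply: (is_derive_eq (is_derive_mul (is_derive_sub
  (is_derive_mul (is_derive_add (is_derive_mul (is_derive_cst1 7 k) dk2)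
    (is_derive_cst1 1 k)) ds)
  (is_derive_mul (is_derive_sqr (is_derive_sub dk2 (is_derive_cst1 1 k)))
    (is_derive_inv (f := fun y => s y t) s0 ds))) (is_derive_cst1 18^-1 k))).
rewrite /radial_kernel_derivative /angular_derivative sin2cos2 -/c.
have wE : sqdist k t = 1 + k ^+ 2 + 2 * k * c by [].
move: s0 (sqr_dist k t); set q := s k t => s0 q2 /=.
transitivity ((14 * k * sqdist k t ^+ 2 + (7 * k ^+ 2 + 1) * (k + c) * sqdist k t
  - 4 * k * (k ^+ 2 - 1) * sqdist k t + (k ^+ 2 - 1) ^+ 2 * (k + c))
   / q ^+ 3 / 18).
  by rewrite -q2; field.
transitivity ((18 * k * sqdist k t ^+ 2 - (k ^+ 2 - 1) *
   (2 * c * sqdist k t + 2 * k * (1 - c ^+ 2))) / q ^+ 3 / 18).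
  by congr (_ / _ / _); rewrite wE; ring.
by rewrite -q2; field.
Qed.

Lemma continuous_sin2M : continuous (fun t : R => sin (2 * t)).
Proof.
move=> t; apply: continuous_comp; last exact: continuous_sin.
by apply: cvgM; [exact: cvg_cst|exact: cvg_id].
Qed.

Lemma continuous_angular_derivative k : k ^+ 2 != 1 ->
  continuous (angular_derivative k).
Proof.
move=> k1 t; rewrite /angular_derivative; apply: cvgD; apply: cvgM.
- by apply: cvgM; [exact: cvg_cst|exact: continuous_cos2M].
- exact: continuous_distV.
- apply: cvgM; first exact: cvg_cst.
  apply: (@continuous_comp _ _ _ (fun t => sin (2 * t)) (fun x => x ^+ 2)).
    exact: continuous_sin2M.
  exact: exprn_continuous.
- apply: cvgV; first by rewrite expf_neq0// dist_neq0.
  apply: (@continuous_comp _ _ _ (fun t => s k t) (fun x => x ^+ 3)).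
    exact: continuous_dist.
  exact: exprn_continuous.
Qed.

(** The angular term integrates to zero, since [sin (2 t)] vanishes at both
    ends. *)
Lemma Rintegral_radial_kernel_derivative k : k ^+ 2 != 1 ->
  \int[mu]_(t in `[0, pi / 2]) radial_kernel_derivative k t = k * dist_integral k.
Proof.
move=> k1; have cA := continuous_angular_derivative k1.
have iA := continuous_integrable 0 (pi / 2) cA.
have iI := continuous_integrable 0 (pi / 2) (@continuous_dist _ k).
rewrite /radial_kernel_derivative RintegralB//; last 2 first.
- apply: continuous_integrable => t.
  by apply: cvgM; [exact: cvg_cst|exact: continuous_dist].
- apply: continuous_integrable => t.
  by apply: cvgM; [exact: cvg_cst|exact: cA].
have A0 : \int[mu]_(t in `[0, pi / 2]) angular_derivative k t = 0.
  rewrite (FTC_Rintegral pihalf_ge0 (continuous_itv cA) _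
    (fun t _ => is_derive_angular t k1)).
    rewrite mulr0 sin0 (_ : 2 * (pi / 2) = pi); last by field.
    by rewrite sinpi !mul0r subrr.
  by apply: continuous_itv => t; apply: is_derive_continuous (is_derive_angular t k1).
by rewrite !RintegralZl// A0 mulr0 subr0.
Qed.

(** A bound that does not depend on [t] and is uniform as long as [`|k|] is
    bounded and stays away from [1]; it dominates the integrand when the
    integral is differentiated. *)
Lemma radial_kernel_derivative_bound k t e B : 0 < e -> `|k| <= B ->
  e <= `|1 - `|k| | -> `|radial_kernel_derivative k t| <=
  B * (1 + B) + (B ^+ 2 + 1) / 18 * (2 / e + 2 * B / e ^+ 3).
Proof.
move=> e0 kB ek; have es := le_trans ek (dist_ge k t).
have s0 := lt_le_trans e0 es.
have B0 : 0 <= B by apply: le_trans kB.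
have sV : (s k t)^-1 <= e^-1 by rewrite lef_pV2.
have sV3 : (s k t ^+ 3)^-1 <= (e ^+ 3)^-1.
  by rewrite lef_pV2 ?posrE ?exprn_gt0// lerXn2r// nnegrE ltW.
have c1 : `|cos (2 * t)| <= 1 by rewrite ler_norml cos_geN1 cos_le1.
have si1 : `|sin (2 * t) ^+ 2| <= 1.
  by rewrite normrX exprn_ile1// ler_norml sin_geN1 sin_le1.
rewrite /radial_kernel_derivative (le_trans (ler_normB _ _))// lerD//.
  rewrite normrM ler_pM// ger0_norm ?sqrtr_ge0// (le_trans (dist_le _ _))//.
  by rewrite lerD2l.
rewrite normrM ler_pM//.
  rewrite normrM ler_pM//; last by rewrite ger0_norm.
  rewrite (le_trans (ler_normB _ _))// normr1 lerD2r normrX.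
  by rewrite lerXn2r ?nnegrE.
rewrite /angular_derivative (le_trans (ler_normD _ _))// lerD//.
  rewrite normrM ler_pM//; last by rewrite ger0_norm ?invr_ge0 ?sqrtr_ge0.
  by rewrite normrM (ger0_norm (ler0n _ 2)) ler_piMr.
rewrite normrM ler_pM//; last first.
  by rewrite ger0_norm// invr_ge0 exprn_ge0// sqrtr_ge0.
rewrite normrM -[leRHS]mulr1 ler_pM// normrM (ger0_norm (ler0n _ 2)).
by rewrite ler_pM2l.
Qed.

Lemma is_derive_radial_primitive k : k ^+ 2 != 1 ->
  is_derive k 1 (@radial_primitive R) (k * dist_integral k).
Proof.
(* Within [e] of [k] the absolute value stays at distance at least [e] from
   [1]. *)
move=> k1; pose e := `|1 - `|k| | / 2.
have ke : 0 < `|1 - `|k| |.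
  rewrite normr_gt0 subr_eq0 eq_sym; apply: contra k1 => /eqP k1.
  by rewrite -real_normK ?num_real// k1 expr1n.
have e0 : 0 < e by rewrite divr_gt0.
have near_k x : `]k - e, k + e[%classic x -> `|x| <= `|k| + e /\ e <= `|1 - `|x| |.
  rewrite /= in_itv/= => /andP[h1 h2].
  have xk : `|x - k| < e by rewrite ltr_norml; lra.
  have xk2 : `| `|x| - `|k| | < e by apply: le_lt_trans xk; exact: ler_dist_dist.
  split; first by move: xk2; rewrite ltr_norml; lra.
  have : `|1 - `|k| | <= `|1 - `|x| | + `| `|x| - `|k| |.
    by apply: le_trans (ler_normD _ _); rewrite addrA subrK.
  rewrite {1}(_ : `|1 - `|k| | = e + e); last by rewrite /e; field.
  lra.
have near1 x : `]k - e, k + e[%classic x -> x ^+ 2 != 1.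
  move=> /near_k[_]; apply: contraTneq => /eqP; rewrite -ltNge.
  rewrite -real_normK ?num_real// sqrf_eq1 => /orP[/eqP->|/eqP x1].
    by rewrite subrr normr0.
  by have := normr_ge0 x; rewrite x1 ler0N1.
have kI : `]k - e, k + e[%classic k by rewrite /= in_itv/= ltrBlDr ltrDl e0.
have -> : @radial_primitive R =
    fun x => \int[mu]_(t in `[0, pi / 2]) radial_kernel x t.
  by apply/funext => x; exact: radial_primitiveE.
pose B := `|k| + e.
pose M : R := B * (1 + B) + (B ^+ 2 + 1) / 18 * (2 / e + 2 * B / e ^+ 3).
have dE x t : `]k - e, k + e[%classic x ->
    partial1of2 radial_kernel x t = radial_kernel_derivative x t.
  move=> /near1 x1; rewrite partial1of2E; apply: derive_val.
  exact: is_derive_radial_kernel.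
have M0 : 0 <= M.
  have [kB ek] := near_k _ kI.
  exact: le_trans (normr_ge0 _) (radial_kernel_derivative_bound 0 e0 kB ek).
have intQ x : `]k - e, k + e[%classic x ->
    mu.-integrable `[0, pi / 2] (EFin \o radial_kernel x).
  by move=> _; apply: continuous_integrable; exact: continuous_radial_kernel.
have derQ x t : `]k - e, k + e[%classic x -> `[0, pi / 2]%classic t ->
    derivable (radial_kernel ^~ t) x 1.
  by move=> /near1 x1 _; have [] := is_derive_radial_kernel t x1.
have intM : mu.-integrable `[0, pi / 2] (EFin \o cst M).
  by apply: continuous_integrable; exact: cst_continuous.
have bd x t : `]k - e, k + e[%classic x -> `[0, pi / 2]%classic t ->
    `|partial1of2 radial_kernel x t| <= M.
  move=> xI _; rewrite dE//; have [xB ex] := near_k _ xI.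
  exact: radial_kernel_derivative_bound.
have mI : measurable (`[0, pi / 2]%classic : set R) by exact: measurable_itv.
apply: DeriveDef.
  exact: (@derivable_under_integral R _ _ mu radial_kernel _ mI _ _ _ kI intQ derQ
    (cst M) (fun=> M0) intM bd).
rewrite -derive1E (@differentiation_under_integral R _ _ mu radial_kernel _ mI
  _ _ _ kI intQ derQ (cst M) (fun=> M0) intM bd).
rewrite -Rintegral_radial_kernel_derivative//; apply: eq_Rintegral => t _.
exact: dE.
Qed.

Lemma continuous_dist_integral : continuous (@dist_integral R).
Proof.
move=> k.
have mI : measurable (`[0, pi / 2]%classic : set R) by exact: measurable_itv.
apply: (@continuity_under_integral R _ _ mu (fun k t => s k t) _ mI
  (k - 1) (k + 1) _ _ (cst (1 + (`|k| + 1)))).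
- by move=> x _; apply: continuous_integrable; exact: continuous_dist.
- apply: aeW => t _ x _.
  apply: (@continuous_comp _ _ _ (fun k => sqdist k t) Num.sqrt); last exact: sqrt_continuous.
  apply: cvgD.
    by apply: cvgD; [exact: cvg_cst|exact: exprn_continuous].
  by apply: cvgM; [apply: cvgM; [exact: cvg_cst|exact: cvg_id]|exact: cvg_cst].
- by apply: continuous_integrable; exact: cst_continuous.
- move=> x; rewrite /= in_itv/= => /andP[h1 h2]; apply: aeW => t _.
  rewrite ger0_norm ?sqrtr_ge0// (le_trans (dist_le _ _))// lerD2l.
  have -> : x = k + (x - k) by ring.
  by rewrite (le_trans (ler_normD _ _))// lerD2l ler_norml; lra.
- by rewrite inE/= in_itv/=; lra.
Qed.

Lemma invdist_integral_ge0 k : 0 <= invdist_integral k.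
Proof. by apply: Rintegral_ge0 => t _; rewrite invr_ge0 sqrtr_ge0. Qed.

(** The distance is at least [`|1 - `|k| |], which up to the factor
    [1 + `|k|] cancels one of the two factors [k ^+ 2 - 1]; what remains tends to
    zero as [`|k|] tends to [1], although [invdist_integral] is unbounded there. *)
Lemma invdist_integral_bound k :
  (k ^+ 2 - 1) ^+ 2 * invdist_integral k <= `|k ^+ 2 - 1| * (1 + `|k|) * (pi / 2).
Proof.
have [k1|k1] := eqVneq (k ^+ 2) 1.
  by rewrite k1 subrr expr0n/= normr0 !mul0r.
have ke : 0 < `|1 - `|k| |.
  rewrite normr_gt0 subr_eq0 eq_sym; apply: contra k1 => /eqP k1.
  by rewrite -real_normK ?num_real// k1 expr1n.
have h : invdist_integral k <= `|1 - `|k| |^-1 * (pi / 2).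
  have -> : `|1 - `|k| |^-1 * (pi / 2) =
      \int[mu]_(t in `[0, pi / 2]) (cst `|1 - `|k| |^-1 t).
    rewrite Rintegral_cst//= lebesgue_measure_itv/= lte_fin.
    by rewrite divr_gt0 ?pi_gt0//= subr0.
  apply: le_Rintegral => //.
  - by apply: continuous_integrable; exact: continuous_distV.
  - by apply: continuous_integrable; exact: cst_continuous.
  - by move=> t _; rewrite /= lef_pV2 ?posrE ?dist_gt0// dist_ge.
apply: (@le_trans _ _ ((k ^+ 2 - 1) ^+ 2 * (`|1 - `|k| |^-1 * (pi / 2)))).
  by rewrite ler_wpM2l// sqr_ge0.
rewrite mulrA ler_wpM2r ?pihalf_ge0// ler_pdivrMr// -[leLHS]real_normK ?num_real//.
suff -> : `|k ^+ 2 - 1| = `|1 - `|k| | * (1 + `|k|)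
  by rewrite le_eqVlt; apply/orP; left; apply/eqP; ring.
rewrite -[X in _ * X]ger0_norm ?addr_ge0// -normrM distrC -(real_normK (num_real k)).
by congr `|_|; ring.
Qed.

Lemma continuous_radial_primitive : continuous (@radial_primitive R).
Proof.
move=> k; have [k1|k1] := eqVneq (k ^+ 2) 1; last first.
  exact: is_derive_continuous (is_derive_radial_primitive k1).
have ck2 : {for k, continuous (fun x : R => x ^+ 2)} by exact: exprn_continuous.
apply: cvgM; last exact: cvg_cst.
apply: cvgB.
  apply: cvgM; last exact: continuous_dist_integral.
  by apply: cvgD; [apply: cvgM; [exact: cvg_cst|exact: ck2]|exact: cvg_cst].
rewrite [X in _ --> X](_ : _ = 0); last by rewrite k1 subrr expr0n/= mul0r.
apply: (@squeeze_cvgr _ _ _ _ (cst 0)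
    (fun x => `|x ^+ 2 - 1| * (1 + `|x|) * (pi / 2))).
- apply: nearW => x; rewrite invdist_integral_bound andbT.
  by rewrite mulr_ge0 ?sqr_ge0 ?invdist_integral_ge0.
- exact: cvg_cst.
- rewrite [X in _ --> X](_ : _ = `|k ^+ 2 - 1| * (1 + `|k|) * (pi / 2)); last first.
    by rewrite k1 subrr normr0 !mul0r.
  apply: cvgM; last exact: cvg_cst.
  apply: cvgM.
    by apply: cvg_norm; apply: cvgB; [exact: ck2|exact: cvg_cst].
  by apply: cvgD; [exact: cvg_cst|apply: cvg_norm; exact: cvg_id].
Qed.

Lemma sqdist0 t : sqdist 0 t = 1 :> R.
Proof. by rewrite /sqdist expr0n/= addr0 mulr0 mul0r addr0. Qed.

Lemma dist_integral0 : dist_integral 0 = pi / 2 :> R.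
Proof.
rewrite /dist_integral; under eq_Rintegral do rewrite sqdist0 sqrtr1.
rewrite Rintegral_cst//= lebesgue_measure_itv/= lte_fin divr_gt0 ?pi_gt0//=.
by rewrite subr0 mul1r.
Qed.

Lemma dist_integral1 : dist_integral 1 = 2 :> R.
Proof.
rewrite /dist_integral (@eq_Rintegral _ _ _ mu _ (fun t => 2 * cos t)); last first.
  move=> t; rewrite inE/= in_itv/= => /andP[t0 tp].
  have -> : sqdist 1 t = (2 * cos t) ^+ 2.
    by rewrite /sqdist cos2M exprMn cos2sin2; ring.
  rewrite sqrtr_sqr ger0_norm// mulr_ge0// cos_ge0_pihalf// tp andbT.
  by rewrite (le_trans _ t0)// oppr_le0 pihalf_ge0.
transitivity (2 * sin (pi / 2) - 2 * sin 0 : R); last first.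
  by rewrite sin_pihalf sin0 mulr0 mulr1 subr0.
apply: (@FTC_Rintegral _ (fun t => 2 * cos t) (fun t => 2 * sin t)).
- exact: pihalf_ge0.
- by apply: continuous_itv => t; apply: cvgM; [exact: cvg_cst|exact: continuous_cos].
- by apply: continuous_itv => t; apply: cvgM; [exact: cvg_cst|exact: continuous_sin].
Qed.

Lemma radial_primitive0 : radial_primitive 0 = 0 :> R.
Proof.
rewrite /radial_primitive (_ : invdist_integral 0 = dist_integral 0).
  by rewrite expr0n/=; ring.
by apply: eq_Rintegral => t _; rewrite sqdist0 sqrtr1 invr1.
Qed.

(** The derivative of [radial_primitive] is not available at [1], that is at
    [x = r ^+ 2], so a radius larger than [r] requires two intervals. *)
Lemma Rintegral_dist_integral_sqrt r a : 0 < r -> 0 <= a ->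
  \int[mu]_(x in `[0, a ^+ 2]) dist_integral (Num.sqrt x / r) =
  2 * r ^+ 2 * radial_primitive (a / r).
Proof.
move=> r0 a0; pose f x := dist_integral (Num.sqrt x / r).
pose F x := 2 * r ^+ 2 * radial_primitive (Num.sqrt x / r).
have cs : continuous (fun x : R => Num.sqrt x / r).
  by move=> x; apply: cvgM; [exact: sqrt_continuous|exact: cvg_cst].
have cf : continuous f.
  by move=> x; apply: (@continuous_comp _ _ _ (fun x => Num.sqrt x / r));
    [exact: cs|exact: continuous_dist_integral].
have cF : continuous F.
  move=> x; apply: cvgM; first exact: cvg_cst.
  by apply: (@continuous_comp _ _ _ (fun x => Num.sqrt x / r));
    [exact: cs|exact: continuous_radial_primitive].
have dF x : 0 < x -> x != r ^+ 2 -> is_derive x 1 F (f x).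
  move=> x0 xr; have sx0 : 0 < Num.sqrt x by rewrite sqrtr_gt0.
  have k1 : (Num.sqrt x / r) ^+ 2 != 1.
    rewrite expr_div_n sqr_sqrtr ?ltW//; apply: contra xr => /eqP E.
    by rewrite -[x](divfK (_ : r ^+ 2 != 0)) ?E ?mul1r// expf_neq0// gt_eqF.
  have dk := is_derive_mul (is_derive1_sqrt x0) (is_derive_cst1 r^-1 x).
  have dG := is_derive_comp (g := fun y => Num.sqrt y / r)
    (is_derive_radial_primitive k1) dk.
  apply: (is_derive_eq (is_derive_mul (is_derive_cst1 (2 * r ^+ 2) x) dG)).
  by rewrite /f; field; rewrite !gt_eqF.
have F0 : F 0 = 0 by rewrite /F sqrtr0 mul0r radial_primitive0 mulr0.
have Fa : 2 * r ^+ 2 * radial_primitive (a / r) = F (a ^+ 2).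
  by rewrite /F sqrtr_sqr ger0_norm.
have a20 : 0 <= a ^+ 2 by exact: sqr_ge0.
rewrite Fa -[RHS]subr0 -[X in _ = _ - X]F0; have [ar|ra] := leP (a ^+ 2) (r ^+ 2).
  apply: (@FTC_Rintegral _ f F) => [|||x /andP[x0 xa]]; [by []|exact: continuous_itv..|].
  by apply: dF => //; rewrite lt_eqF// (lt_le_trans xa).
rewrite (Rintegral_cat (sqr_ge0 r) (ltW ra))//.
have cut (u v w : R) : u - w = (v - w) + (u - v) by ring.
rewrite (cut _ (F (r ^+ 2))).
congr (_ + _).
  apply: (@FTC_Rintegral _ f F) => [|||x /andP[x0 xa]]; [exact: sqr_ge0|exact: continuous_itv..|].
  by apply: dF => //; rewrite lt_eqF.
apply: (@FTC_Rintegral _ f F) => [|||x /andP[x0 xa]]; [exact: ltW|exact: continuous_itv..|].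
by apply: dF; rewrite ?gt_eqF// (lt_trans _ x0)// exprn_gt0.
Qed.

End radial.

(** * Reduction to complete elliptic integrals *)

Section elliptic.
Context {R : realType}.
Implicit Types (k t r a x : R).
Notation mu := (@lebesgue_measure R).
Local Notation s k t := (Num.sqrt (sqdist k t)).
Local Notation m k := (2 * Num.sqrt k / (k + 1)).
Local Notation delta k t := (Num.sqrt (1 - k ^+ 2 * sin t ^+ 2)).

Lemma integral_EFin (f : R -> R) a b : continuous f ->
  (\int[mu]_(x in `[a, b]) (f x)%:E)%E = (\int[mu]_(x in `[a, b]) f x)%:E.
Proof.
move=> cf; rewrite /Rintegral fineK//; apply: integrable_fin_num => //.
exact: continuous_integrable.
Qed.

Lemma delta_modulusE k t : 0 <= k -> delta (m k) t = s k t / (1 + k).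
Proof.
move=> k0; have k1 : 0 < 1 + k by rewrite ltr_pwDl.
rewrite -[1 + k in RHS]ger0_norm ?ltW// -sqrtr_sqr -sqrtrV ?sqr_ge0//.
rewrite -sqrtrM ?sqdist_ge0//; congr Num.sqrt.
rewrite /sqdist cos2M expr_div_n exprMn sqr_sqrtr//.
by field; rewrite gt_eqF.
Qed.

(** Both formulas for this modulus come from
    [sqdist k t = (1 + k) ^+ 2 - 4 * k * sin t ^+ 2]. *)
Lemma ellipticE_landen_modulus k : 0 <= k ->
  ellipticE (m k) = (dist_integral k / (1 + k))%:E.
Proof.
move=> k0; rewrite /ellipticE; under eq_integral do rewrite delta_modulusE//.
rewrite integral_EFin; last first.
  by move=> t; apply: cvgM; [exact: continuous_dist|exact: cvg_cst].
by rewrite RintegralZr//; apply: continuous_integrable; exact: continuous_dist.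
Qed.

Lemma ellipticK_landen_modulus k : 0 <= k -> k ^+ 2 != 1 ->
  ellipticK (m k) = ((1 + k) * invdist_integral k)%:E.
Proof.
move=> k0 k1; rewrite /ellipticK.
under eq_integral do rewrite delta_modulusE// invf_div.
rewrite integral_EFin; last first.
  by move=> t; apply: cvgM; [exact: cvg_cst|exact: continuous_distV].
by rewrite RintegralZl//; apply: continuous_integrable; exact: continuous_distV.
Qed.

Lemma dist_inv_modulus k t : 0 < k -> s k t = k * s k^-1 t.
Proof.
move=> k0; rewrite -{2}(gtr0_norm k0) -sqrtr_sqr -sqrtrM ?sqr_ge0//.
by congr Num.sqrt; rewrite /sqdist; field; rewrite gt_eqF.
Qed.

Lemma dist_integral_inv_modulus k : 0 < k -> dist_integral k = k * dist_integral k^-1.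
Proof.
move=> k0; rewrite /dist_integral; under eq_Rintegral do rewrite dist_inv_modulus//.
by rewrite RintegralZl//; apply: continuous_integrable; exact: continuous_dist.
Qed.

Lemma invdist_integral_inv_modulus k : 0 < k -> k ^+ 2 != 1 ->
  invdist_integral k = k^-1 * invdist_integral k^-1.
Proof.
move=> k0 k1; rewrite /invdist_integral; under eq_Rintegral do rewrite dist_inv_modulus// invfM.
rewrite RintegralZl//; apply: continuous_integrable; apply: continuous_distV.
by rewrite exprVn invr_eq1.
Qed.

(** [T] need not be monotone on the segment: both sides are increments of
    [F \o T], with [F] a primitive of [g] to the right of [N]. *)
Lemma Rintegral_substitution (g T T' : R -> R) a b N : a <= b -> T a <= T b ->
  N < T a -> (forall x, a < x < b -> N < T x) ->
  continuous g -> continuous T -> continuous T' ->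
  (forall x, a < x < b -> is_derive x 1 T (T' x)) ->
  \int[mu]_(x in `[T a, T b]) g x = \int[mu]_(x in `[a, b]) (g (T x) * T' x).
Proof.
move=> ab Tab Na NT cg cT cT' dT; have [F dF] := ex_primitive N cg.
rewrite (Rintegral_primitive cg dF)//; apply/esym.
have NT' x : a <= x <= b -> N < T x.
  move=> /andP[]; rewrite le_eqVlt => /predU1P[<- //|ax].
  rewrite le_eqVlt => /predU1P[->|xb]; first exact: lt_le_trans Tab.
  by apply: NT; rewrite ax.
apply: (@FTC_Rintegral _ _ (fun x => F (T x))) => // [||x xab].
- apply: continuous_itv => x; apply: cvgM; last exact: cT'.
  by apply: (@continuous_comp _ _ _ T g); [exact: cT|exact: cg].
- apply: continuous_in_subspaceT => x; rewrite inE/= in_itv/= => xab.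
  apply: (@continuous_comp _ _ _ T F); first exact: cT.
  exact: is_derive_continuous (dF _ (NT' _ xab)).
- exact: is_derive_comp (dF _ (NT _ xab)) (dT _ xab).
Qed.

(** Landen's change of variable.  In a triangle with sides [1] and [k], let [x] be
    the angle between the side [k] and the third side; twice this value is then
    the supplement of the angle between the sides [1] and [k].  The interval
    [[0, pi]] is mapped onto [[0, pi / 2]]. *)
Definition landen_angle k x : R := (x + asin (k * sin x)) / 2.

Section landen.
Context (k : R) (k0 : 0 <= k) (k1 : k < 1).

Let k_neq1 : k ^+ 2 != 1.
Proof. by rewrite lt_eqF// exprn_ilt1. Qed.

Let ksin x : -1 < k * sin x < 1.
Proof.
rewrite -ltr_norml normrM (ger0_norm k0) (le_lt_trans _ k1)// ler_piMr//.
by rewrite ler_norml sin_geN1 sin_le1.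
Qed.

Let w_gt0 x : 0 < 1 - k ^+ 2 * sin x ^+ 2.
Proof. by rewrite subr_gt0 -exprMn -real_normK ?num_real// exprn_ilt1// ltr_norml. Qed.

Let d_gt0 x : 0 < delta k x.
Proof. by rewrite sqrtr_gt0. Qed.

Let continuous_ksin : continuous (fun x => k * sin x).
Proof. by move=> x; apply: cvgM; [exact: cvg_cst|exact: continuous_sin]. Qed.

Let continuous_delta : continuous (fun x => delta k x).
Proof.
move=> x; apply: (@continuous_comp _ _ _ (fun x => 1 - k ^+ 2 * sin x ^+ 2) Num.sqrt).
  apply: cvgB; [exact: cvg_cst|apply: cvgM; first exact: cvg_cst].
  apply: (@continuous_comp _ _ _ sin (fun x : R => x ^+ 2)); first exact: continuous_sin.
  exact: exprn_continuous.
exact: sqrt_continuous.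
Qed.

Let continuous_deltaV : continuous (fun x => (delta k x)^-1).
Proof.
by move=> x; apply: cvgV; [rewrite gt_eqF|exact: continuous_delta].
Qed.

Let continuous_landen : continuous (landen_angle k).
Proof.
move=> x; apply: cvgM; last exact: cvg_cst.
apply: cvgD; first exact: cvg_id.
apply: (@continuous_comp _ _ _ (fun x => k * sin x) asin); first exact: continuous_ksin.
exact: continuous_asin.
Qed.

Let landen' x := (1 + k * cos x / delta k x) / 2.

Let is_derive_landen x : is_derive x 1 (landen_angle k) (landen' x).
Proof.
have d1 := is_derive_mul (is_derive_cst1 k x) (is_derive_sin x).
have d2 := is_derive_comp (g := fun x => k * sin x) (is_derive1_asin (ksin x)) d1.
apply: (is_derive_eq (is_derive_mul (is_derive_add (is_derive_id1 x) d2)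
  (is_derive_cst1 2^-1 x))).
by rewrite /landen' exprMn; field; rewrite gt_eqF.
Qed.

Let continuous_landen' : continuous landen'.
Proof.
move=> x; apply: cvgM; last exact: cvg_cst.
apply: cvgD; first exact: cvg_cst.
apply: cvgM; last exact: continuous_deltaV.
by apply: cvgM; [exact: cvg_cst|exact: continuous_cos].
Qed.

Let landen_gt x : 0 <= x -> - pi < landen_angle k x.
Proof.
have /andP[h1 h2] := ksin x => x0.
have ha : - (pi / 2) <= asin (k * sin x) by apply: asin_geNpi2; rewrite !ltW.
by have := pi_gt0 R; rewrite /landen_angle; lra.
Qed.

Let dist_landen x : s k (landen_angle k x) = delta k x + k * cos x.
Proof.
have /andP[h1 h2] := ksin x.
have kc : `|k * cos x| <= delta k x.
  rewrite -sqrtr_sqr ler_wsqrtr// exprMn cos2sin2.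
  have : k ^+ 2 <= 1 by rewrite exprn_ile1// ltW.
  lra.
rewrite -[RHS]ger0_norm; last by move: kc; rewrite ler_norml; lra.
rewrite -sqrtr_sqr; congr Num.sqrt; rewrite /sqdist /landen_angle.
rewrite (_ : 2 * ((x + asin (k * sin x)) / 2) = x + asin (k * sin x)); last by field.
rewrite cosD asinK; last by rewrite in_itv/= !ltW.
rewrite cos_asin ?ltW// exprMn.
have := sqr_sqrtr (ltW (w_gt0 x)); set d := Num.sqrt _ => d2.
rewrite sqrrD d2 exprMn cos2sin2; ring.
Qed.

Lemma landen_substitution (g : R -> R) : continuous g ->
  \int[mu]_(x in `[0, pi / 2]) g x =
  \int[mu]_(x in `[0, pi]) (g (landen_angle k x) * landen' x).
Proof.
move=> cg; have pi0 := pi_ge0 R.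
have asin0 : asin (0 : R) = 0.
  by rewrite -[in LHS]sin0 sinK// in_itv/= oppr_le0 pihalf_ge0.
have T0 : landen_angle k 0 = 0 by rewrite /landen_angle sin0 mulr0 asin0 addr0 mul0r.
have Tpi : landen_angle k pi = pi / 2.
  by rewrite /landen_angle sinpi mulr0 asin0 addr0.
rewrite -{1}T0 -Tpi; apply: (@Rintegral_substitution _ _ _ _ _ (- pi)) => //.
- by rewrite T0 Tpi pihalf_ge0.
- exact: landen_gt.
- by move=> x /andP[x0 _]; exact/landen_gt/ltW.
Qed.

Let Rintegral_half (f : R -> R) : continuous f -> (forall x, f (pi - x) = f x) ->
  \int[mu]_(x in `[0, pi]) f x = 2 * \int[mu]_(x in `[0, pi / 2]) f x.
Proof.
move=> cf fs; rewrite -{1}pi_halfD Rintegral_symmetric ?pihalf_ge0// => x.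
by rewrite pi_halfD.
Qed.

Let delta_sym x : delta k (pi - x) = delta k x.
Proof. by rewrite (addrC pi) sinDpi sinN opprK. Qed.

Let intD := continuous_integrable 0 pi continuous_delta.
Let intDV := continuous_integrable 0 pi continuous_deltaV.

(** The length of the third side is [delta k x + k * cos x], and it is also the
    factor in the derivative of the angle, so the two cancel. *)
Lemma ellipticK_landen : ellipticK k = (invdist_integral k)%:E.
Proof.
rewrite /ellipticK integral_EFin//; congr EFin.
rewrite /invdist_integral landen_substitution; last exact: continuous_distV.
rewrite (_ : \int[mu]_(x in `[0, pi]) _ =
    \int[mu]_(x in `[0, pi]) (2^-1 * (delta k x)^-1)); last first.
  apply: eq_Rintegral => x _.
  have := @dist_gt0 _ k (landen_angle k x) k_neq1; rewrite dist_landen => ?.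
  by rewrite /landen'; field; rewrite !gt_eqF.
rewrite RintegralZl// Rintegral_half//; last by move=> x; rewrite delta_sym.
by rewrite mulrA mulVf// mul1r.
Qed.

(** Here the length of the third side enters squared; the term [k * cos x]
    coming from the expansion has integral zero over [[0, pi]]. *)
Lemma ellipticE_landen :
  ellipticE k = ((dist_integral k + (1 - k ^+ 2) * invdist_integral k) / 2)%:E.
Proof.
have [KJ] : (invdist_integral k)%:E = (\int[mu]_(x in `[0, pi / 2]) (delta k x)^-1)%:E.
  by rewrite -ellipticK_landen /ellipticK integral_EFin.
rewrite /ellipticE integral_EFin//; congr EFin.
rewrite KJ /dist_integral landen_substitution; last exact: continuous_dist.
have ck2 : continuous (fun x => (1 - k ^+ 2) / 2 * (delta k x)^-1).
  by move=> x; apply: cvgM; [exact: cvg_cst|exact: continuous_deltaV].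
have cc : continuous (fun x => k * cos x).
  by move=> x; apply: cvgM; [exact: cvg_cst|exact: continuous_cos].
have cs : \int[mu]_(x in `[0, pi]) cos x = 0.
  rewrite (@FTC_Rintegral _ cos sin) ?sinpi ?sin0 ?subrr ?pi_ge0//.
    by apply: continuous_itv; exact: continuous_cos.
  by apply: continuous_itv; exact: continuous_sin.
rewrite (_ : \int[mu]_(x in `[0, pi]) _ = \int[mu]_(x in `[0, pi])
    (delta k x - (1 - k ^+ 2) / 2 * (delta k x)^-1 + k * cos x)); last first.
  apply: eq_Rintegral => x _; rewrite dist_landen /landen'.
  have := sqr_sqrtr (ltW (w_gt0 x)); have := d_gt0 x.
  set d := Num.sqrt _ => dp d2.
  transitivity ((d ^+ 2 + 2 * k * cos x * d + k ^+ 2 * cos x ^+ 2) / (2 * d)).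
    by field; rewrite gt_eqF.
  transitivity ((2 * d ^+ 2 - (1 - k ^+ 2) + 2 * k * cos x * d) / (2 * d)).
    by congr (_ / _); rewrite d2 cos2sin2; ring.
  by field; rewrite gt_eqF.
have cB : continuous (fun x => delta k x - (1 - k ^+ 2) / 2 * (delta k x)^-1).
  by move=> x; apply: cvgB; [exact: continuous_delta|exact: ck2].
rewrite RintegralD//; last 2 first.
- exact: continuous_integrable.
- exact: continuous_integrable.
rewrite RintegralB//; last exact: continuous_integrable.
rewrite !RintegralZl//; last first.
  by apply: continuous_integrable; exact: continuous_cos.
have fD := Rintegral_half continuous_delta delta_sym.
have fDV : \int[mu]_(x in `[0, pi]) (delta k x)^-1 =
    2 * \int[mu]_(x in `[0, pi / 2]) (delta k x)^-1.
  by apply: Rintegral_half => // x; rewrite delta_sym.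
by rewrite cs fD fDV; field.
Qed.

End landen.
End elliptic.

(** * The squared norm of a uniform point of a disk *)

Section law.
Context {R : realType}.
Implicit Types (t a x : R).
Notation mu := (@lebesgue_measure R).

Definition sqnorm2 (p : R * R) : R := p.1 ^+ 2 + p.2 ^+ 2.

Lemma measurable_sqnorm2 : measurable_fun setT sqnorm2.
Proof.
by apply: measurable_funD; apply: measurable_funX;
  [exact: measurable_fst|exact: measurable_snd].
Qed.

Lemma measurable_disk t : measurable (disk t).
Proof.
have := measurable_sqnorm2 measurableT (measurable_itv `]-oo, t ^+ 2]).
by rewrite setTI; congr (measurable _).
Qed.

(** The formula also holds when the line misses the disk, since the square root
    of a negative number is [0]. *)
Lemma xsection_disk t x :
  mu (xsection (disk t) x) = (2 * Num.sqrt (t ^+ 2 - x ^+ 2))%:E.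
Proof.
have [xt|tx] := leP (x ^+ 2) (t ^+ 2); last first.
  rewrite (_ : xsection _ _ = set0) ?measure0; last first.
    apply/seteqP; split => y // /xsectionP; rewrite /disk/= => h.
    by have := sqr_ge0 y; move: tx h; lra.
  by rewrite ler0_sqrtr ?mulr0// subr_le0 ltW.
have -> : xsection (disk t) x =
    `[- Num.sqrt (t ^+ 2 - x ^+ 2), Num.sqrt (t ^+ 2 - x ^+ 2)]%classic.
  apply/seteqP; split => y.
    move=> /xsectionP; rewrite /disk/= in_itv/= -ler_norml => h.
    by rewrite -sqrtr_sqr ler_wsqrtr// lerBrDl.
  rewrite /= in_itv/= -ler_norml => h; apply/xsectionP; rewrite /disk/=.
  rewrite -lerBrDl -(real_normK (num_real y)).
  rewrite -[leRHS]sqr_sqrtr ?subr_ge0//.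
  by rewrite lerXn2r// nnegrE.
rewrite lebesgue_measure_itv/= lte_fin; case: ifPn => [_|].
  by rewrite -EFinB; congr EFin; ring.
rewrite -leNgt => h; congr EFin.
by have := sqrtr_ge0 (t ^+ 2 - x ^+ 2); move: h; lra.
Qed.

(** The area is the integral of the lengths of the vertical chords, computed with
    the substitution [x = t * sin u]. *)
Lemma area_disk t : 0 <= t -> area (disk t) = (t ^+ 2 * pi)%:E.
Proof.
move=> t0; rewrite /area /product_measure1.
pose g x := 2 * Num.sqrt (t ^+ 2 - x ^+ 2).
have cg : continuous g.
  move=> x; apply: cvgM; first exact: cvg_cst.
  apply: (@continuous_comp _ _ _ (fun x => t ^+ 2 - x ^+ 2) Num.sqrt);
    last exact: sqrt_continuous.
  by apply: cvgB; [exact: cvg_cst|exact: exprn_continuous].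
transitivity (\int[mu]_(x in `[(- t)%R, t]) (g x)%:E)%E.
  rewrite [RHS]integral_mkcond; apply: eq_integral => x _ /=.
  rewrite xsection_disk patchE; case: ifPn => //.
  rewrite notin_setE/= in_itv/= => /negP; rewrite -ler_norml -ltNge => tx.
  rewrite ler0_sqrtr ?mulr0// subr_le0 -(real_normK (num_real x)).
  by rewrite lerXn2r ?nnegrE// ltW.
rewrite integral_EFin//; congr EFin; have p0 := @pihalf_ge0 R.
have pp : - (pi / 2) <= pi / 2 :> R by lra.
have csin : continuous (fun x => t * sin x).
  by move=> x; apply: cvgM; [exact: cvg_cst|exact: continuous_sin].
have ccos : continuous (fun x => t * cos x).
  by move=> x; apply: cvgM; [exact: cvg_cst|exact: continuous_cos].
have dsin x : - (pi / 2) < x < pi / 2 -> is_derive x 1 (fun x => t * sin x) (t * cos x).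
  move=> _; apply: (is_derive_eq (is_derive_mul (is_derive_cst1 t x) (is_derive_sin x))).
  by rewrite mulr0 addr0.
have h := @Rintegral_substitution _ g (fun x => t * sin x) (fun x => t * cos x)
  (- (pi / 2)) (pi / 2) (- t - 1) pp.
rewrite sinN sin_pihalf mulrN mulr1 in h; rewrite h//; last 3 first.
- by lra.
- by lra.
- move=> x _; have : - t <= t * sin x.
    by rewrite -[leLHS]mulr1 mulNr -mulrN ler_wpM2l// sin_geN1.
  lra.
have -> : t ^+ 2 * pi = t ^+ 2 * (pi / 2 + sin (pi / 2) * cos (pi / 2))
    - t ^+ 2 * (- (pi / 2) + sin (- (pi / 2)) * cos (- (pi / 2))).
  by rewrite sinN cosN cos_pihalf; field.
rewrite (@eq_Rintegral _ _ _ mu _ (fun x => t ^+ 2 * (2 * cos x ^+ 2))); last first.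
  move=> x; rewrite inE/= in_itv/= => xpp.
  rewrite /g exprMn -[X in X - _]mulr1 -mulrBr -cos2sin2 -exprMn sqrtr_sqr.
  by rewrite ger0_norm; [ring|rewrite mulr_ge0// cos_ge0_pihalf].
have d x : is_derive x 1 (fun x => t ^+ 2 * (x + sin x * cos x))
    (t ^+ 2 * (2 * cos x ^+ 2)).
  apply: (is_derive_eq (is_derive_mul (is_derive_cst1 (t ^+ 2) x) (is_derive_add
    (is_derive_id1 x) (is_derive_mul (is_derive_sin x) (is_derive_cos x))))).
  have := cos2sin2 x => c2; ring: c2.
apply: (@FTC_Rintegral _ _ (fun x => t ^+ 2 * (x + sin x * cos x))) => //.
- apply: continuous_itv => x; apply: cvgM; first exact: cvg_cst.
  apply: cvgM; first exact: cvg_cst.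
  by apply: (@continuous_comp _ _ _ cos (fun x : R => x ^+ 2));
    [exact: continuous_cos|exact: exprn_continuous].
- by apply: continuous_itv => x; exact: is_derive_continuous (d x).
Qed.

Lemma eq_measure_ray (m1 m2 : {measure set (measurableTypeR R) -> \bar R}) :
  (forall x, m1 `]x, +oo[%classic = m2 `]x, +oo[%classic) ->
  (m1 setT < +oo)%E ->
  forall A, measurable A -> m1 A = m2 A.
Proof.
move=> m12 m1T; apply: (@measure_unique _ R (measurableTypeR R) (@RGenOInfty.G R)
  (fun n => `](- n%:R)%R, +oo[%classic) _ _ _ _ m1 m2).
- exact: RGenOInfty.measurableE.
- move=> _ _ [x ->] [y ->]; exists (Num.max x y).
  by apply/seteqP; split => z /=; rewrite !in_itv/= !andbT gt_max => /andP.
- by move=> n; eexists.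
- apply/seteqP; split => // x _; exists (Num.bound `|x|) => //=.
  rewrite in_itv/= andbT ltrNl (le_lt_trans (ler_norm _))// normrN.
  by rewrite archi_boundP.
- by move=> _ [x ->].
- move=> n; apply: le_lt_trans m1T; apply: le_measure => //; rewrite inE;
  [exact: measurable_itv|exact: measurableT].
Qed.

Section uniform.
Context d (T : measurableType d) (P : probability T R) (a : R)
  (Z : {RV P >-> (R * R)%type}) (a0 : 0 < a)
  (uZ : uniformly_distributed_on_disk a Z).

Let a20 : 0 < a ^+ 2. Proof. exact: exprn_gt0. Qed.

(** The part of the disk outside a concentric disk of squared radius [x] has area
    [pi * (a ^+ 2 - x)], a proportion [1 - x / a ^+ 2] of the whole. *)
Lemma sqnorm2_law x :
  distribution P Z (sqnorm2 @^-1` `]x, +oo[%classic) =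
  uniform_prob a20 `]x, +oo[%classic.
Proof.
have mS : measurable (sqnorm2 @^-1` `]x, +oo[%classic).
  by rewrite -[X in measurable X]setTI; exact: measurable_sqnorm2.
have mI : measurable (`]x, +oo[ `&` `[0, a ^+ 2] : set R).
  by apply: measurableI; exact: measurable_itv.
have -> : uniform_prob a20 `]x, +oo[%classic =
    ((a ^+ 2)^-1%:E * mu (`]x, +oo[ `&` `[0%R, (a ^+ 2)%R]))%E.
  rewrite /uniform_prob integral_uniform_pdf.
  rewrite (eq_integral (fun=> (a ^+ 2)^-1%:E)) ?integral_cst// => y.
  by rewrite inE/= => -[_]; rewrite in_itv/= /uniform_pdf => ->; rewrite subr0.
have pa : (area (disk a))^-1%E = (a ^+ 2 * pi)^-1%:E.
  by rewrite area_disk ?ltW// inver gt_eqF// mulr_gt0// pi_gt0.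
have pi_neq0 : pi != 0 :> R by rewrite gt_eqF// pi_gt0.
rewrite uZ// /uniform_disk gt_eqF// {}pa.
have [x0|x0] := ltP x 0.
  have -> : sqnorm2 @^-1` `]x, +oo[ `&` disk a = disk a.
    apply/setIidPr => p _; rewrite /= in_itv/= andbT (lt_le_trans x0)//.
    by rewrite addr_ge0 ?sqr_ge0.
  have -> : `]x, +oo[ `&` `[0, a ^+ 2] = `[0, a ^+ 2]%classic :> set R.
    by apply/setIidPr => y; rewrite /= !in_itv/= andbT => /andP[y0 _]; exact: lt_le_trans y0.
  rewrite area_disk ?ltW// lebesgue_measure_itv/= lte_fin a20 -EFinB -!EFinM.
  by congr EFin; move: pi pi_neq0 => c c0; field; rewrite c0 gt_eqF.
have [xa|ax] := leP x (a ^+ 2).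
  have -> : sqnorm2 @^-1` `]x, +oo[ `&` disk a = disk a `\` disk (Num.sqrt x).
    apply/seteqP; split => p /=; rewrite /disk /= in_itv/= andbT sqr_sqrtr// /sqnorm2.
      by move=> [xp pa']; split => //; apply/negP; rewrite -ltNge.
    by move=> [pa' /negP]; rewrite -ltNge.
  have aD : (area (disk a `\` disk (Num.sqrt x)) =
      area (disk a) - area (disk a `&` disk (Num.sqrt x)))%E.
    apply: measureD; [exact: measurable_disk|exact: measurable_disk|].
    by rewrite -[ltLHS]/(area (disk a)) area_disk ?ltW// ltry.
  rewrite {}aD setIidr; last first.
    by move=> p; rewrite /disk/= sqr_sqrtr// => h; exact: le_trans xa.
  rewrite !area_disk ?sqrtr_ge0 ?(ltW a0)// sqr_sqrtr//.
  have -> : `]x, +oo[ `&` `[0, a ^+ 2] = `]x, a ^+ 2]%classic :> set R.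
    apply/seteqP; split => y; rewrite /= !in_itv/= andbT.
      by move=> [-> /andP[_ ->]].
    by move=> /andP[xy ->]; rewrite xy (le_trans x0) ?(ltW xy).
  rewrite lebesgue_measure_itv/= lte_fin; case: ifPn => [_|].
    rewrite -!EFinB -!EFinM; congr EFin.
    by move: pi pi_neq0 => c c0; field; rewrite c0 gt_eqF.
  rewrite -leNgt => ax; have -> : x = a ^+ 2 by apply/eqP; rewrite eq_le xa.
  by rewrite mule0 -EFinB subrr mul0e.
have -> : sqnorm2 @^-1` `]x, +oo[ `&` disk a = set0.
  apply/seteqP; split => p // []; rewrite /disk/= in_itv/= andbT => h1 h2.
  by have := lt_trans ax (lt_le_trans h1 h2); rewrite ltxx.
have -> : `]x, +oo[ `&` `[0, a ^+ 2] = set0 :> set R.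
  apply/seteqP; split => y // []; rewrite /= !in_itv/= andbT => h1 /andP[_ h2].
  by have := lt_trans ax (lt_le_trans h1 h2); rewrite ltxx.
by rewrite /area !measure0 mul0e mule0.
Qed.

Lemma expectation_sqnorm2 (f : R -> R) : continuous f -> (forall x, 0 <= f x) ->
  'E_P[fun w => f (sqnorm2 (Z w))]%E =
  ((a ^+ 2)^-1%:E * \int[mu]_(x in `[0%R, (a ^+ 2)%R]) (f x)%:E)%E.
Proof.
move=> cf f0; rewrite unlock.
have mf : measurable_fun [set: R] (fun x => (f x)%:E).
  by apply/measurable_EFinP; exact: continuous_measurable_fun.
have mX : measurable_fun setT (sqnorm2 \o Z : T -> measurableTypeR R).
  exact: measurableT_comp measurable_sqnorm2 (measurable_funPT Z).
pose X : {mfun T >-> measurableTypeR R} :=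
  @mfun_Sub _ _ T (measurableTypeR R) (sqnorm2 \o Z) (mem_set mX).
pose PX : probability (measurableTypeR R) R := distribution P X.
transitivity (\int[PX]_x (f x)%:E)%E.
  by rewrite ge0_integral_distribution// => x; rewrite lee_fin.
rewrite -[X in (X^-1%:E * _)%E]subr0 -(integral_uniform a20)//.
apply: (@eq_measure_integral _ _ _ _ (uniform_prob a20) PX) => A mA _.
apply: (@eq_measure_ray PX) => //; first exact: sqnorm2_law.
by rewrite -[ltLHS]/(PX setT) probability_setT ltry.
Qed.

End uniform.
End law.

(** * The expected perimeter *)

Section expected_perimeter.
Context {R : realType} (d : measure_display) (T : measurableType d)
  (P : probability T R) (r a : R) (Z : {RV P >-> (R * R)%type})
  (r0 : 0 < r) (uZ : uniformly_distributed_on_disk a Z).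
Notation mu := (@lebesgue_measure R).

Let f x := 4 * r * dist_integral (Num.sqrt x / r).

Let perimeter_sqnorm2 : (fun t => perimeter r (Z t)) = (fun t => f (sqnorm2 (Z t))).
Proof. by apply/funext => t; rewrite perimeterE. Qed.

Let cI : continuous (fun x => dist_integral (Num.sqrt x / r)).
Proof.
move=> x; apply: (@continuous_comp _ _ _ (fun x => Num.sqrt x / r));
  last exact: continuous_dist_integral.
by apply: cvgM; [exact: sqrt_continuous|exact: cvg_cst].
Qed.

Let cf : continuous f.
Proof. by move=> x; apply: cvgM; [exact: cvg_cst|exact: cI]. Qed.

Let f_ge0 x : 0 <= f x.
Proof.
rewrite mulr_ge0//; first by rewrite mulr_ge0// ltW.
by apply: Rintegral_ge0 => t _; exact: sqrtr_ge0.
Qed.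

Lemma expectation_perimeter : 0 < a ->
  'E_P[fun t => perimeter r (Z t)]%E =
  (8 * r / (a / r) ^+ 2 * radial_primitive (a / r))%:E.
Proof.
move=> a0; rewrite perimeter_sqnorm2 (expectation_sqnorm2 a0 uZ cf f_ge0).
rewrite integral_EFin// -EFinM; congr EFin.
rewrite /f RintegralZl//; last exact: continuous_integrable.
by rewrite Rintegral_dist_integral_sqrt ?ltW//; field; rewrite !gt_eqF.
Qed.

(** For [a = 0] the law of [Z] is a Dirac mass and the circle of radius [r] is
    the only curve that occurs. *)
Lemma expectation_perimeter0 : a = 0 ->
  'E_P[fun t => perimeter r (Z t)]%E = (2 * pi * r)%:E.
Proof.
move=> a0; rewrite perimeter_sqnorm2 unlock.
have mf : measurable_fun [set: R * R] (fun p => (f (sqnorm2 p))%:E).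
  apply/measurable_EFinP; apply: (@measurableT_comp _ _ _ _ _ _ f);
    last exact: measurable_sqnorm2.
  exact: continuous_measurable_fun.
transitivity (\int[distribution P Z]_p (f (sqnorm2 p))%:E)%E.
  by rewrite ge0_integral_distribution// => p; rewrite lee_fin.
pose D : {measure set (R * R)%type -> \bar R} := \d_((0, 0) : R * R).
rewrite (@eq_measure_integral _ _ _ setT D); last first.
  by move=> A mA _; apply: (eq_trans (uZ mA)); rewrite /uniform_disk a0 eqxx.
rewrite integral_dirac// diracE mem_set// mul1e /f /sqnorm2 expr0n/= addr0.
rewrite sqrtr0 mul0r dist_integral0; by congr EFin; field.
Qed.

End expected_perimeter.

Theorem theorem4p1 (R : realType) (d : measure_display) (T : measurableType d)
    (P : probability T R) (r a : R) (Z : {RV P >-> (R * R)%type}) :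
  0 < r -> 0 <= a ->
  uniformly_distributed_on_disk a Z ->
  let k := a / r in
  let EU := 'E_P[fun t => perimeter r (Z t)]%E in
  EU =
    (if k == 0 then (2 * pi * r)%:E
     else if k < 1 then
       ((8 * r / (9 * k ^+ 2))%:E *
        ((7 * k ^+ 2 + 1)%:E * ellipticE k +
         (3 * k ^+ 4 - 2 * k ^+ 2 - 1)%:E * ellipticK k))%E
     else if k == 1 then (64 * r / 9)%:E
     else
       ((8 * r / (9 * k))%:E *
        ((7 * k ^+ 2 + 1)%:E * ellipticE k^-1 -
         (4 * (k ^+ 2 - 1))%:E * ellipticK k^-1))%E) /\
  (0 < k < 1 \/ 1 < k ->
   EU =
     ((4 * (k + 1) * r / (9 * k ^+ 2))%:E *
      ((7 * k ^+ 2 + 1)%:E * ellipticE (2 * Num.sqrt k / (k + 1)) -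
       ((k - 1) ^+ 2)%:E * ellipticK (2 * Num.sqrt k / (k + 1))))%E).
Proof.
move=> r0 a0 uZ k EU; have k0 : 0 <= k by rewrite divr_ge0// ltW.
have EU_pos : 0 < k -> EU = (8 * r / k ^+ 2 * radial_primitive k)%:E.
  by rewrite /k pmulr_lgt0 ?invr_gt0// => a_gt0; exact: expectation_perimeter.
have k_neq1 : k != 1 -> k ^+ 2 != 1.
  apply: contra; rewrite sqrf_eq1 => /orP[//|/eqP kE].
  by move: k0; rewrite kE oppr_ge0 ler10.
split; last first.
  move=> hk; have kp : 0 < k by case: hk => [/andP[]//|/(lt_trans ltr01)].
  have k1 : k != 1 by case: hk => [/andP[_ /lt_eqF->]//|/gt_eqF->].
  rewrite EU_pos// ellipticE_landen_modulus// ellipticK_landen_modulus// ?k_neq1//.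
  rewrite -!EFinM; congr EFin; rewrite /radial_primitive.
  by field; rewrite !gt_eqF//= ltr_pwDl.
have [kE|kn0] := eqVneq k 0.
  apply: (expectation_perimeter0 r0 uZ); move/eqP: kE.
  by rewrite mulf_eq0 invr_eq0 (gt_eqF r0) orbF => /eqP.
have kp : 0 < k by rewrite lt_neqAle eq_sym kn0.
rewrite EU_pos//; have [k1|k1|k1] := ltgtP k 1.
- rewrite ellipticE_landen// ellipticK_landen//.
  rewrite -!EFinM; congr EFin; rewrite /radial_primitive.
  by field.
- have ki : k^-1 < 1 by rewrite invf_lt1.
  rewrite ellipticE_landen ?invr_ge0// ellipticK_landen ?invr_ge0//.
  rewrite -!EFinM; congr EFin; rewrite /radial_primitive.
  rewrite (dist_integral_inv_modulus kp) (invdist_integral_inv_modulus kp) ?k_neq1 ?gt_eqF//.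
  by field.
- by congr EFin; rewrite /radial_primitive k1 dist_integral1; field.
Qed.
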